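(* Let $H$ be a real Hilbert space and let $K\subseteq H$ be a pointed closed convex cone. Then $K$ is subdual (i.e. $K\subseteq K^*$) if and only if the normalized angular distance $\operatorname{ad}(\cdot,K)$ is $K$-antitone on $H\setminus\{0\}$, i.e. for all $x,y\in H\setminus\{0\}$, $x\le_K y$ implies $\operatorname{ad}(y,K)\le\operatorname{ad}(x,K)$.
   Context: $H$ is a real Hilbert space with inner product $\langle\cdot,\cdot\rangle$ and norm $\lVert x\rVert=\sqrt{\langle x,x\rangle}$. A closed convex cone is a nonempty closed set $K\subseteq H$ such that $\lambda x+\mu y\in K$ for all $x,y\in K$ and all real $\lambda,\mu\ge 0$. It is pointed if $K\cap(-K)=\{0\}$. The relation $\le_K$ is defined by $x\le_K y\iff y-x\in K$. The dual cone is $K^*=\{x\in H:\langle x,y\rangle\ge 0\text{ for every }y\in K\}$ and the polar cone is $K^\circ=-K^*$. $K$ is subdual if $K\subseteq K^*$. For $x\in H\setminus\{0\}$, the normalized angular distance from $x$ to $K$ is \[ \operatorname{ad}(x,K)=\begin{cases}\displaystyle\frac{2}{\pi}\inf_{y\in K\setminus\{0\}}\arccos\left(\frac{\langle x,y\rangle}{\lVert x\rVert\,\lVert y\rVert}\right), & x\notin K^\circ,\\[2ex] 1, & x\in K^\circ.\end{cases} \] *)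

(* Defs.v *)
From HB Require Import structures.
From mathcomp Require Import all_boot all_order all_algebra.
From mathcomp Require Import all_classical all_reals all_analysis.
Import Order.TTheory GRing.Theory Num.Theory.
Import numFieldNormedType.Exports.

Set Implicit Arguments.
Unset Strict Implicit.
Unset Printing Implicit Defensive.

Local Open Scope classical_set_scope.
Local Open Scope ring_scope.

(* A real Hilbert space is a complete normed module [H] over a [realType],
   together with a symmetric positive definite form [dot : {dot H for idfun}]
   that induces its norm. *)
Definition induces_norm (R : realType) (H : completeNormedModType R)
    (dot : {dot H for idfun}) : Prop :=
  forall x : H, `|x| = Num.sqrt (dot x x).

Section Cones.
Variables (R : realType) (H : completeNormedModType R).
Implicit Types (K D : set H) (x y : H).

Definition closed_convex_cone K : Prop :=
  [/\ K !=set0, closed K &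
      forall x y (l m : R), K x -> K y -> 0 <= l -> 0 <= m ->
        K (l *: x + m *: y)].

Definition pointed K : Prop := K `&` (-%R @` K) = [set 0].

Definition cone_le K x y : Prop := K (y - x).

Definition cone_antitone_on K D (f : H -> R) : Prop :=
  forall x y, D x -> D y -> cone_le K x y -> f y <= f x.

Variable dot : {dot H for idfun}.

Definition dual_cone K : set H := [set x | forall y, K y -> 0 <= dot x y].

Definition polar_cone K : set H := -%R @` dual_cone K.

Definition subdual K : Prop := K `<=` dual_cone K.

(* Only meaningful for [x != 0]; the value at [0] is the junk value [1]. For
   [x \notin polar_cone K] the infimum is over a nonempty set of reals that is
   bounded below, so the real-valued [inf] is the actual infimum. *)
Definition angular_distance x K : R :=
  if x \in polar_cone K then 1
  else 2 / pi * inf [set acos (dot x y / (`|x| * `|y|)) | y in K `\ 0].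

End Cones.

(* Main.v *)
Require Import Defs.
From HB Require Import structures.
From mathcomp Require Import all_boot all_order all_algebra.
From mathcomp Require Import all_classical all_reals all_analysis.
From mathcomp Require Import ring lra.
Import Order.TTheory GRing.Theory Num.Theory.
Import numFieldNormedType.Exports.
Local Open Scope classical_set_scope.
Local Open Scope ring_scope.

(** The inequality between cosines carries all the content: [acos] being
    decreasing on [[-1, 1]], [ad(x, K)] is governed by the supremum of
    [cos(x, z)] over nonzero [z] in [K], where
    [cos(x, z) = <x, z> / (|x| |z|)].

    If [K] is subdual, let [y = x + k] with [k] in [K] and let [z] in [K] make
    an acute angle with [x]. Some [w] in [K] makes at most that angle with [y]
    ([subdual_cosine_le]). If [|y| <= |x|], take [w = z]: passing to [y] does
    not decrease the inner product with [z], by subduality, and does not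
    increase the norm. If [|x| < |y|], take [w = t z + k], where [t z] is the
    projection of [x] onto the ray of [z]: then [y - w = x - t z], so the sine
    of the angle at [y] is at most [|x - t z| / |y|], while at [x] it equals
    [|x - t z| / |x|].

    Conversely, if [K] is not subdual, some [p], [k] in [K] have
    [<p, k> < 0]. As [K] is pointed and closed, the ray [p - t k] leaves [K];
    projecting a point of it outside [K] back onto [K] gives a point [P] of [K]
    with [<P, k> < 0] and a nonzero outward normal [q] to [K] at [P]
    ([not_subdual_support]). Put [x = P + l q] and [y = x + d k] for a small
    [d > 0] and a large [l]. The nearest direction to [x] in [K] is [P], while
    [<y, z> <= <P + d k, z>] on [K], so the cosines of the two angles to [K]
    are [|P| / |x|] and at most [|P + d k| / |y|]. Moving along [k] shortens [P]
    to first order, and for large [l] this outweighs the possible decrease of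
    [|y|], which is of lower order in [l]. Thus the angle to [K] increases from
    [x] to [y], against antitonicity ([antitone_subdual]). *)

(** * Monotonicity of the arc cosine *)

Lemma le_acos (R : realType) (a b : R) : -1 <= a -> a <= b -> b <= 1 ->
  acos b <= acos a.
Proof.
move=> a1 ab b1.
have [/andP[a0 api] ca] := @acos_def R a ltac:(by rewrite a1 (le_trans ab)).
have [/andP[b0 bpi] cb] := @acos_def R b ltac:(by rewrite b1 (le_trans a1)).
rewrite leNgt -ltr_cos ?in_itv/= ?a0 ?b0 ?api ?bpi//.
by rewrite ca cb -leNgt.
Qed.

Lemma lt_acos (R : realType) (a b : R) : -1 <= a -> a < b -> b <= 1 ->
  acos b < acos a.
Proof.
move=> a1 ab b1.
have [/andP[a0 api] ca] := @acos_def R a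
  ltac:(by rewrite a1 (le_trans (ltW ab))).
have [/andP[b0 bpi] cb] := @acos_def R b
  ltac:(by rewrite b1 (le_trans a1 (ltW ab))).
by rewrite -ltr_cos ?in_itv/= ?a0 ?b0 ?api ?bpi// ca cb.
Qed.

Lemma pi2_gt0 (R : realType) : 0 < 2 / pi :> R.
Proof. by rewrite divr_gt0// pi_gt0. Qed.

(** * Inner product *)

Section Hilbert.
Variables (R : realType) (H : completeNormedModType R).
Variable dot : {dot H for idfun}.
Hypothesis dot_norm : induces_norm dot.
Implicit Types (x y z k p q v w : H) (K : set H).

Local Notation "''[' x , y ]" := (dot x y) (format "''[' x ,  y ]").

Lemma dotC x y : '[x, y] = '[y, x].
Proof. by rewrite hermC /= expr0 mul1r. Qed.

Lemma dotDl x y z : '[x + y, z] = '[x, z] + '[y, z].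
Proof. exact: linearDl. Qed.

Lemma dotDr x y z : '[z, x + y] = '[z, x] + '[z, y].
Proof. exact: linearDr. Qed.

Lemma dotZl a x z : '[a *: x, z] = a * '[x, z].
Proof. exact: linearZl_LR. Qed.

Lemma dotZr a x z : '[z, a *: x] = a * '[z, x].
Proof. exact: linearZr_LR. Qed.

Lemma dotNl x z : '[- x, z] = - '[x, z].
Proof. exact: linearNl. Qed.

Lemma dotNr x z : '[z, - x] = - '[z, x].
Proof. exact: linearNr. Qed.

Definition dotE := (dotDl, dotDr, dotNl, dotNr, dotZl, dotZr).

Lemma dot_sqnorm x : '[x, x] = `|x| ^+ 2.
Proof.
rewrite dot_norm sqr_sqrtr//.
have [->|x0] := eqVneq x 0; first by rewrite linear0l.
by rewrite ltW// neq0_dnorm_gt0.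
Qed.

Lemma dot_ge0 x : 0 <= '[x, x].
Proof. by rewrite dot_sqnorm sqr_ge0. Qed.

Lemma Cauchy_Schwarz x y : '[x, y] <= `|x| * `|y|.
Proof.
have [->|x0] := eqVneq x 0; first by rewrite linear0l normr0 mul0r.
have [->|y0] := eqVneq y 0; first by rewrite linear0r normr0 mulr0.
have := dot_ge0 (`|y| *: x - `|x| *: y).
rewrite !dotE !dot_sqnorm (dotC y x) => h.
have : 0 < `|x| * `|y| by rewrite mulr_gt0// normr_gt0.
nra.
Qed.

(** Zero vectors are allowed: division by zero gives the quotient [0]. *)
Lemma cosine_range x y : -1 <= '[x, y] / (`|x| * `|y|) <= 1.
Proof.
have [/eqP|] := eqVneq (`|x| * `|y|) 0.
  by move=> /eqP->; rewrite invr0 mulr0 lerN10 ler01.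
move=> n0; have xy0 : 0 < `|x| * `|y| by rewrite lt_neqAle eq_sym n0 mulr_ge0.
rewrite ler_pdivlMr// ler_pdivrMr// mul1r Cauchy_Schwarz andbT.
by have := Cauchy_Schwarz (- x) y; rewrite dotNl normrN mulN1r; lra.
Qed.

(** * Angular distance *)

Lemma not_polarP x K :
  reflect (exists2 z, K z & 0 < '[x, z]) (x \notin polar_cone dot K).
Proof.
apply: (iffP idP) => [|[z Kz xz]].
  move=> xK; apply: contrapT => nz; move/negP: xK; apply; rewrite inE.
  exists (- x); last by rewrite opprK.
  move=> z Kz; rewrite dotNl oppr_ge0 leNgt; apply/negP => xz.
  by apply: nz; exists z.
apply/negP; rewrite inE => -[w /(_ z Kz) wz wx].
by move: xz; rewrite -wx dotNl oppr_gt0 ltNge wz.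
Qed.

Lemma angular_distance_le x K z : x \notin polar_cone dot K -> K z -> z != 0 ->
  angular_distance dot x K <= 2 / pi * acos ('[x, z] / (`|x| * `|z|)).
Proof.
move=> xK Kz z0; rewrite /angular_distance (negbTE xK) ler_pM2l ?pi2_gt0//.
apply: ge_inf; last by exists z => //; split => //; exact/eqP.
by exists 0 => _ [w _ <-]; rewrite acos_ge0 ?cosine_range.
Qed.

Lemma le_angular_distance x K a : x \notin polar_cone dot K ->
  (forall z, K z -> z != 0 ->
     a <= 2 / pi * acos ('[x, z] / (`|x| * `|z|))) ->
  a <= angular_distance dot x K.
Proof.
move=> xK ax; rewrite /angular_distance (negbTE xK) mulrC.
rewrite -ler_pdivrMr ?pi2_gt0//.
apply: lb_le_inf.
  case/not_polarP : xK => z Kz xz; exists (acos ('[x, z] / (`|x| * `|z|))).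
  exists z => //; split => // z0; move: xz.
  by rewrite z0 linear0r ltxx.
move=> _ [z [Kz z0] <-]; rewrite ler_pdivrMr ?pi2_gt0// mulrC; apply: ax => //.
exact/eqP.
Qed.

(** A vector outside the polar cone makes an acute angle with some element of
    [K], so the infimum is at most a right angle. *)
Lemma angular_distance_le1 x K : angular_distance dot x K <= 1.
Proof.
have [xK|xK] := boolP (x \in polar_cone dot K).
  by rewrite /angular_distance xK.
have [z Kz xz] := not_polarP _ _ xK.
have z0 : z != 0 by apply: contraTneq xz => ->; rewrite linear0r ltxx.
apply: (le_trans (angular_distance_le _ _ _ xK Kz z0)).
have : acos ('[x, z] / (`|x| * `|z|)) <= acos (0 : R).
  apply: le_acos; rewrite ?lerN10//; last by case/andP: (cosine_range x z).
  by rewrite divr_ge0// ?mulr_ge0// ltW.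
rewrite acos0 -(ler_pM2l (pi2_gt0 R)) => /le_trans; apply.
by rewrite mulf_div [2 * pi]mulrC divff// mulf_neq0// gt_eqF// pi_gt0.
Qed.

(** * Closed convex cones *)

Section Cone.
Variable K : set H.
Hypothesis K_cone : closed_convex_cone K.

Lemma coneD x y : K x -> K y -> K (x + y).
Proof.
case: K_cone => _ _ KD Kx Ky.
by have := KD x y 1 1 Kx Ky ler01 ler01; rewrite !scale1r.
Qed.

Lemma coneZ a x : 0 <= a -> K x -> K (a *: x).
Proof.
case: K_cone => _ _ KD a0 Kx.
by have := KD x x a 0 Kx Kx a0 (lexx 0); rewrite scale0r addr0.
Qed.

Lemma cone0 : K 0.
Proof.
by case: K_cone => -[x Kx] _ _; rewrite -(scale0r x); apply: coneZ.
Qed.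

(** * Subdual cones have antitone angular distance *)

(** Comparing [x] and [y] through an arbitrary [z], instead of a nearest
    direction, gives the inequality between the infima directly. In the case
    [|x| < |y|], [w] compares the sines of the two angles; in the case
    [|y| <= |x|] that comparison may fail and [z] itself serves. *)
Lemma subdual_cosine_le x y z : subdual dot K -> x != 0 -> y != 0 ->
  K (y - x) -> K z -> z != 0 -> 0 < '[x, z] ->
  exists w, [/\ K w, w != 0 &
    '[x, z] / (`|x| * `|z|) <= '[y, w] / (`|y| * `|w|)].
Proof.
move=> Ksub x0 y0 Kk Kz z0 xz.
have yE : y = x + (y - x) by rewrite addrC subrK.
set k := y - x in Kk yE *.
have X0 : 0 < `|x| by rewrite normr_gt0.
have Y0 : 0 < `|y| by rewrite normr_gt0.
have Z0 : 0 < `|z| by rewrite normr_gt0.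
have [YX|XY] := leP `|y| `|x|.
  exists z; split=> //.
  have kz : 0 <= '[k, z] by apply: Ksub.
  apply: (@le_trans _ _ ('[y, z] / (`|x| * `|z|))).
    by rewrite ler_pM2r ?invr_gt0 ?mulr_gt0// yE dotDl lerDl.
  rewrite ler_pM2l; first by rewrite lef_pV2 ?posrE ?mulr_gt0// ler_pM2r.
  by rewrite yE dotDl ltr_wpDr.
(* [t *: z] is the orthogonal projection of [x] onto the ray of [z]. *)
pose t := '[x, z] / `|z| ^+ 2.
have tz : t * `|z| ^+ 2 = '[x, z] by rewrite divfK// expf_neq0// gt_eqF.
have t0 : 0 <= t by rewrite divr_ge0 ?sqr_ge0// ltW.
have [w wE] : exists w, w = t *: z + k by exists (t *: z + k).
have Kw : K w by rewrite wE; apply: coneD => //; apply: coneZ.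
pose Q := `|x - t *: z| ^+ 2.
have Q0 : 0 <= Q by rewrite sqr_ge0.
have QX : '[x, z] ^+ 2 = `|z| ^+ 2 * (`|x| ^+ 2 - Q).
  rewrite /Q -!dot_sqnorm !dotE (dotC z x) !dot_sqnorm.
  rewrite -tz; ring.
have QY : 2 * '[y, w] = `|w| ^+ 2 + (`|y| ^+ 2 - Q).
  have -> : Q = `|y - w| ^+ 2.
    by congr (`|_| ^+ 2); rewrite wE {1}yE opprD addrACA subrr addr0.
  rewrite -!dot_sqnorm !dotE (dotC w y); ring.
have QleX : Q <= `|x| ^+ 2.
  have := sqr_ge0 '[x, z]; rewrite QX pmulr_rge0 ?exprn_gt0//; lra.
have XY2 : `|x| ^+ 2 < `|y| ^+ 2 by rewrite ltr_pXn2r// nnegrE.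
have yw : 0 < '[y, w] by have := sqr_ge0 `|w|; lra.
have w0 : w != 0 by apply: contraTneq yw => ->; rewrite linear0r ltxx.
have W0 : 0 < `|w| by rewrite normr_gt0.
exists w; split=> //.
rewrite ler_pdivrMr ?mulr_gt0// mulrAC ler_pdivlMr ?mulr_gt0//.
rewrite -ler_sqr ?nnegrE ?mulr_ge0 ?(ltW xz) ?(ltW yw)//.
rewrite !exprMn QX.
(* This is [2 sqrt(uv) <= u + v] for [u = |w|^2] and [v = |y|^2 - Q]: the
   distance from [y] to the line of [w] is at most [|y - w|]. *)
have b2 : `|w| ^+ 2 * (`|y| ^+ 2 - Q) <= '[y, w] ^+ 2.
  have -> : '[y, w] = (`|w| ^+ 2 + (`|y| ^+ 2 - Q)) / 2 by rewrite -QY; field.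
  have := sqr_ge0 (`|w| ^+ 2 - (`|y| ^+ 2 - Q)); lra.
apply: (@le_trans _ _
  ((`|w| ^+ 2 * (`|y| ^+ 2 - Q)) * (`|x| ^+ 2 * `|z| ^+ 2))); last first.
  by rewrite ler_wpM2r// mulr_ge0// sqr_ge0.
rewrite -subr_ge0.
have -> : `|w| ^+ 2 * (`|y| ^+ 2 - Q) * (`|x| ^+ 2 * `|z| ^+ 2) -
  `|z| ^+ 2 * (`|x| ^+ 2 - Q) * (`|y| ^+ 2 * `|w| ^+ 2) =
  `|w| ^+ 2 * `|z| ^+ 2 * Q * (`|y| ^+ 2 - `|x| ^+ 2) by ring.
by rewrite !mulr_ge0 ?sqr_ge0// subr_ge0 ltW.
Qed.

Lemma subdual_antitone : subdual dot K ->
  cone_antitone_on K (~` [set 0]) (fun x => angular_distance dot x K).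
Proof.
move=> Ksub x y /eqP x0 /eqP y0 xy.
have [xK|xK] := boolP (x \in polar_cone dot K).
  by rewrite {2}/angular_distance xK angular_distance_le1.
have [z0 Kz0 xz0] := not_polarP _ _ xK.
have yK : y \notin polar_cone dot K.
  apply/not_polarP; exists z0 => //.
  by rewrite -(subrK x y) dotDl ltr_wpDl//; apply: Ksub.
have acute_bound z : K z -> 0 < '[x, z] ->
    angular_distance dot y K <= 2 / pi * acos ('[x, z] / (`|x| * `|z|)).
  move=> Kz xz.
  have z_neq0 : z != 0 by apply: contraTneq xz => ->; rewrite linear0r ltxx.
  have [w [Kw w0 cw]] := subdual_cosine_le _ _ _ Ksub x0 y0 xy Kz z_neq0 xz.
  apply: (le_trans (angular_distance_le _ _ _ yK Kw w0)).
  rewrite ler_pM2l ?pi2_gt0//.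
  apply: le_acos => //; first by case/andP: (cosine_range x z).
  by case/andP: (cosine_range y w).
(* A non-acute [z] is dominated by the acute direction [z0]. *)
apply: le_angular_distance => // z Kz z_neq0.
have [xz|xz] := ltP 0 '[x, z]; first exact: acute_bound.
apply: (le_trans (acute_bound _ Kz0 xz0)); rewrite ler_pM2l ?pi2_gt0//.
apply: le_acos; first by case/andP: (cosine_range x z).
  apply: (@le_trans _ _ 0); first by rewrite mulr_le0_ge0// invr_ge0 mulr_ge0.
  by rewrite divr_ge0 ?mulr_ge0// ltW.
by case/andP: (cosine_range x z0).
Qed.

(** * Projection onto a closed convex cone *)

(** By the parallelogram identity applied to midpoints, a sequence minimizing
    the distance to [v] is Cauchy. *)
Lemma projection_ex v : exists2 p, K p & forall z, K z -> `|v - p| <= `|v - z|.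
Proof.
pose D := inf [set `|v - z| ^+ 2 | z in K].
have D_lb z : K z -> D <= `|v - z| ^+ 2.
  move=> Kz; apply: ge_inf; last by exists z.
  by exists 0 => _ [w _ <-]; rewrite sqr_ge0.
have D_inf : has_inf [set `|v - z| ^+ 2 | z in K].
  split; first by exists (`|v - 0| ^+ 2), 0 => //; exact: cone0.
  by exists 0 => _ [w _ <-]; rewrite sqr_ge0.
have /choice[u uP] (n : nat) : exists z, K z /\ `|v - z| ^+ 2 < D + n.+1%:R^-1.
  have [|_ [z Kz <-] zD] := @inf_adherent R _ n.+1%:R^-1 _ D_inf.
    by rewrite invr_gt0.
  by exists z.
have uK n : K (u n) by case: (uP n).
have uD n : `|v - u n| ^+ 2 < D + n.+1%:R^-1 by case: (uP n).
have uC m n : `|u m - u n| ^+ 2 <= 2 * (m.+1%:R^-1 + n.+1%:R^-1).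
  have Kmid : K (2^-1 *: u m + 2^-1 *: u n).
    by case: K_cone => _ _; apply; rewrite ?invr_ge0.
  have := D_lb _ Kmid; have := uD m; have := uD n.
  rewrite -!dot_sqnorm !dotE (dotC (u m) v) (dotC (u n) v) (dotC (u n) (u m)).
  move: m.+1%:R^-1 n.+1%:R^-1 => em en; lra.
have /cauchy_cvg u_cvg : cauchy (u @ \oo).
  apply: cauchy_exP => e e0.
  have e20 : 0 < e ^+ 2 / 4 by rewrite divr_gt0// exprn_gt0.
  have [N _ small] := near_infty_natSinv_lt (PosNum e20).
  exists (u N); exists N => // n /= Nn; rewrite -ball_normE /ball_ /=.
  rewrite -ltr_sqr ?nnegrE ?(ltW e0)//.
  apply: le_lt_trans (uC N n) _.
  have := small N (leqnn N); have := small n Nn => /=.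
  move: N.+1%:R^-1 n.+1%:R^-1 => eN en; lra.
pose p := lim (u @ \oo).
have Kp : K p.
  apply: (closed_cvg K) u_cvg; first by case: K_cone.
  exact: nearW.
exists p => // z Kz.
rewrite -ler_sqr ?nnegrE//.
apply: le_trans (D_lb _ Kz).
apply/ler_addgt0Pl => e e0.
have vu : `|v - u n| ^+ 2 @[n --> \oo] --> `|v - p| ^+ 2.
  have vu1 : `|v - u n| @[n --> \oo] --> `|v - p|.
    by apply: cvg_norm; apply: cvgB => //; exact: cvg_cst.
  exact: (cvgM vu1 vu1).
apply: (cvgr_to_le vu).
have := near_infty_natSinv_lt (PosNum e0).
apply: filterS => n /= ne; apply: ltW; apply: lt_le_trans (uD n) _.
by rewrite addrC lerD2r ltW.
Qed.

(** Moreau's decomposition of [v] as [p + (v - p)]. Perturbing the minimizer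
    [p] to [p + t z] for [z] in [K] gives the sign condition, and to [p - t p]
    the orthogonality. *)
Lemma moreau v : exists p, [/\ K p, '[v - p, p] = 0,
  forall z, K z -> '[v - p, z] <= 0 & forall z, K z -> `|v - p| <= `|v - z|].
Proof.
have [p Kp pmin] := projection_ex v.
have var z : K (p + z) -> 2 * '[v - p, z] <= '[z, z].
  move=> /pmin; rewrite -[`|v - p| <= _]ler_sqr ?nnegrE// opprD addrA.
  rewrite -!dot_sqnorm.
  move: (v - p) => q; rewrite !dotE (dotC z q); lra.
have small z t : 0 < t -> 2 * '[v - p, t *: z] <= '[t *: z, t *: z] ->
    2 * '[v - p, z] <= t * '[z, z].
  by move=> t0; rewrite !dotZr dotZl mulrCA ler_pM2l.
have lim0 z : (forall t, 0 < t -> t <= 1 -> 2 * '[v - p, z] <= t * '[z, z]) ->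
    '[v - p, z] <= 0.
  move=> h; rewrite leNgt; apply/negP => qz.
  have zz := dot_ge0 z.
  have zz1 : 0 < '[z, z] + 2 * '[v - p, z] by lra.
  (* For [a = 2 <v - p, z>] and [b = <z, z>], the step [a / (a + b)] lies in
     [(0, 1]] and gives [t b < a]. *)
  have /= := h (2 * '[v - p, z] / ('[z, z] + 2 * '[v - p, z])).
  rewrite divr_gt0 ?mulr_gt0// ler_pdivrMr// mul1r lerDr zz => /(_ isT isT).
  rewrite mulrAC ler_pdivlMr//; nra.
have qK z : K z -> '[v - p, z] <= 0.
  move=> Kz; apply: lim0 => t t0 t1; apply: small => //; apply: var.
  by apply: coneD => //; apply: coneZ => //; exact: ltW.
exists p; split=> //.
apply/eqP; rewrite eq_le qK//= -oppr_le0 -dotNr.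
apply: lim0 => t t0 t1; apply: small => //; apply: var.
have -> : p + t *: - p = (1 - t) *: p by rewrite scalerN scalerBl scale1r.
by apply: coneZ => //; rewrite subr_ge0.
Qed.

(** * Antitone angular distance forces subduality *)

(** Otherwise the whole ray lies in [K], and so do the rescaled points
    [p / n - k], whose limit [- k] contradicts pointedness. *)
Lemma pointed_ray_exit p k : pointed K -> K k -> k != 0 ->
  exists2 t, 0 < t & ~ K (p - t *: k).
Proof.
move=> Kpt Kk k0; apply: contrapT => nex; move/eqP: k0; apply.
have inK (n : nat) : K (n.+1%:R^-1 *: p - k).
  have Kn : K (p - n.+1%:R *: k).
    by apply: contrapT => nK; apply: nex; exists n.+1%:R.
  suff -> : n.+1%:R^-1 *: p - k = n.+1%:R^-1 *: (p - n.+1%:R *: k).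
    exact: coneZ.
  by rewrite scalerBr scalerA mulVf ?scale1r// pnatr_eq0.
have Knk : K (- k).
  case: K_cone => _ Kcl _.
  apply: (closed_cvg K Kcl (F := \oo) (u_ := fun n => n.+1%:R^-1 *: p - k)).
    exact: nearW.
  rewrite -[X in _ --> X]add0r; apply: cvgB; last exact: cvg_cst.
  rewrite -(scale0r p); apply: cvgZr_tmp; exact: cvg_harmonic.
have : (K `&` (-%R @` K)) k by split=> //; exists (- k); rewrite ?opprK.
by rewrite Kpt.
Qed.

(** If [v = p - t k] and [P] is its projection, then [|v - P| <= t |k|] because
    [p] is a competitor; hence [<P, k> <= <v, k> + t |k|^2 = <p, k> < 0]. *)
Lemma not_subdual_support : pointed K -> ~ subdual dot K ->
  exists P k q, [/\ K P, K k, '[P, k] < 0, '[q, P] = 0 & q != 0 /\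
    forall z, K z -> '[q, z] <= 0].
Proof.
move=> Kpt nsub.
have [p [k [Kp Kk pk]]] : exists p k, [/\ K p, K k & '[p, k] < 0].
  apply: contrapT => nex; apply: nsub => p Kp k Kk.
  by rewrite leNgt; apply/negP => pk; apply: nex; exists p, k.
have k0 : k != 0 by apply: contraTneq pk => ->; rewrite linear0r ltxx.
have [t t0 vK] := pointed_ray_exit p k Kpt Kk k0.
have [P [KP qP qK Pmin]] := moreau (p - t *: k).
exists P, k, (p - t *: k - P); split=> //; last first.
  by split=> //; apply: contra_notN vK => /eqP/subr0_eq->.
have dP : `|p - t *: k - P| <= t * `|k|.
  have := Pmin _ Kp; rewrite [_ - p]addrAC subrr add0r normrN normrZ.
  by rewrite (ger0_norm (ltW t0)).
have := Cauchy_Schwarz (P - (p - t *: k)) k.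
rewrite [`|P - _|]distrC => /le_trans /(_ (ler_wpM2r (normr_ge0 k) dP)).
rewrite !dotE dot_sqnorm -mulrA -expr2; lra.
Qed.

Lemma antitone_subdual : pointed K ->
  cone_antitone_on K (~` [set 0]) (fun x => angular_distance dot x K) ->
  subdual dot K.
Proof.
move=> Kpt anti; apply: contrapT => /(not_subdual_support Kpt).
move=> [P [k [q [KP Kk Pk qP [q0 qK]]]]].
have k0 : k != 0 by apply: contraTneq Pk => ->; rewrite linear0r ltxx.
have P0 : P != 0 by apply: contraTneq Pk => ->; rewrite linear0l ltxx.
have kk : 0 < '[k, k] by rewrite neq0_dnorm_gt0.
have PP : 0 < '[P, P] by rewrite neq0_dnorm_gt0.
have qq : 0 < '[q, q] by rewrite neq0_dnorm_gt0.
have qk := qK _ Kk.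
(* The minimum of [|P + d k|] is at twice this [d]; taking half of it also
   keeps [<y, P> > 0], so that [y] stays off the polar cone. *)
pose d := - '[P, k] / (2 * '[k, k]).
have d0 : 0 < d by rewrite divr_gt0 ?oppr_gt0// mulr_gt0.
have dk : 2 * (d * '[k, k]) = - '[P, k].
  by rewrite /d; field; rewrite gt_eqF.
(* Large enough for the bracket in the proof of [cos_lt] to be positive. *)
pose l := (1 + 2 * '[P, P] * - '[q, k]) / ('[q, q] * - '[P, k]).
have l0 : 0 < l.
  rewrite divr_gt0 ?mulr_gt0 ?oppr_gt0// ltr_pwDl// mulr_ge0 ?oppr_ge0//.
  by rewrite mulr_ge0// ltW.
have lE : l * ('[q, q] * - '[P, k]) = 1 + 2 * '[P, P] * - '[q, k].
  by rewrite /l divfK// mulf_neq0// gt_eqF// oppr_gt0.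
have Pk2 : '[P, k] ^+ 2 <= '[P, P] * '[k, k].
  have h1 := Cauchy_Schwarz (- P) k.
  rewrite !dot_sqnorm -exprMn -sqrrN -dotNl -(normrN P).
  by rewrite ler_sqr ?nnegrE ?mulr_ge0// dotNl oppr_ge0 ltW.
have dPk : d * - '[P, k] < '[P, P].
  rewrite -(ltr_pM2r kk); apply: lt_le_trans _ Pk2; nra.
clearbody d l.
(* Introduced as opaque names so that bilinearity does not expand them. *)
have [m mE] : exists m, m = P + d *: k by exists (P + d *: k).
have [x xE] : exists x, x = P + l *: q by exists (P + l *: q).
have [y yE] : exists y, y = m + l *: q by exists (m + l *: q).
have PE : '[P, q] = 0 by rewrite dotC.
have xP : '[x, P] = '[P, P] by rewrite xE dotDl dotZl qP mulr0 addr0.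
have yP : 0 < '[y, P].
  rewrite yE mE !dotDl !dotZl qP mulr0 addr0 (dotC k P); lra.
have xPolar : x \notin polar_cone dot K.
  by apply/not_polarP; exists P; rewrite ?xP.
have yPolar : y \notin polar_cone dot K by apply/not_polarP; exists P.
have x0 : x != 0 by apply: contraTneq PP => x0; rewrite -xP x0 linear0l ltxx.
have y0 : y != 0 by apply: contraTneq yP => ->; rewrite linear0l ltxx.
have X0 : 0 < `|x| by rewrite normr_gt0.
have Y0 : 0 < `|y| by rewrite normr_gt0.
have xy : K (y - x).
  have -> : y - x = d *: k.
    by rewrite yE xE mE opprD addrACA subrr addr0 addrAC subrr add0r.
  by apply: coneZ => //; exact: ltW.
have XE : `|x| ^+ 2 = '[P, P] + l ^+ 2 * '[q, q].
  by rewrite -dot_sqnorm xE !dotE PE qP; ring.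
have ME : `|m| ^+ 2 = '[P, P] + 2 * d * '[P, k] + d ^+ 2 * '[k, k].
  by rewrite -dot_sqnorm mE !dotE (dotC k P); ring.
have YE : `|y| ^+ 2 = `|m| ^+ 2 + l ^+ 2 * '[q, q] + 2 * l * d * '[q, k].
  by rewrite -!dot_sqnorm yE mE !dotE PE qP (dotC k q) (dotC k P); ring.
have cos_lt : `|m| / `|y| < `|P| / `|x|.
  rewrite ltr_pdivrMr// mulrAC ltr_pdivlMr//.
  rewrite -ltr_sqr ?nnegrE ?mulr_ge0// !exprMn -(dot_sqnorm P) -subr_gt0.
  have -> : '[P, P] * `|y| ^+ 2 - `|m| ^+ 2 * `|x| ^+ 2 =
      l * d * (l * ('[q, q] * - '[P, k]) * (3 / 2) - 2 * '[P, P] * - '[q, k]).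
    have dk' : d ^+ 2 * '[k, k] = - (d * '[P, k]) / 2.
      by rewrite -mulrN -dk; field.
    by rewrite YE XE ME dk'; field.
  rewrite lE !mulr_gt0//.
  have : 0 <= '[P, P] * - '[q, k] by rewrite mulr_ge0 ?oppr_ge0// ltW.
  lra.
have adx : angular_distance dot x K <= 2 / pi * acos (`|P| / `|x|).
  have := angular_distance_le x K P xPolar KP P0.
  suff -> : '[x, P] / (`|x| * `|P|) = `|P| / `|x| by [].
  by rewrite xP dot_sqnorm; field; rewrite !normr_eq0 x0.
have Px1 : `|P| / `|x| <= 1.
  rewrite ler_pdivrMr// mul1r -ler_sqr ?nnegrE// XE -dot_sqnorm lerDl.
  by rewrite mulr_ge0 ?sqr_ge0// ltW.
have ady : 2 / pi * acos (`|m| / `|y|) <= angular_distance dot y K.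
  apply: le_angular_distance => // z Kz z0; rewrite ler_pM2l ?pi2_gt0//.
  apply: le_acos; first by case/andP: (cosine_range y z).
    rewrite ler_pdivrMr ?mulr_gt0 ?normr_gt0// mulrA divfK ?normr_eq0//.
    apply: le_trans (Cauchy_Schwarz m z).
    by rewrite yE dotDl dotZl gerDl mulr_ge0_le0 ?(ltW l0)// qK.
  exact: le_trans (ltW cos_lt) Px1.
have acos_lt : acos (`|P| / `|x|) < acos (`|m| / `|y|).
  apply: lt_acos => //; apply: (@le_trans _ _ 0); rewrite ?lerN10//.
have adyx : angular_distance dot y K <= angular_distance dot x K.
  by apply: anti => //; exact/eqP.
have := le_trans ady (le_trans adyx adx).
by rewrite ler_pM2l ?pi2_gt0// leNgt acos_lt.
Qed.

End Cone.
End Hilbert.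

Theorem theorem5p5 (R : realType) (H : completeNormedModType R)
    (dot : {dot H for idfun}) (dot_norm : induces_norm dot) (K : set H)
    (K_cone : closed_convex_cone K) (K_pointed : pointed K) :
  subdual dot K <->
  cone_antitone_on K (~` [set 0]) (fun x => angular_distance dot x K).
Proof.
split; first exact: (subdual_antitone _ _ _ dot_norm K K_cone).
exact: (antitone_subdual _ _ _ dot_norm K K_cone K_pointed).
Qed.
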